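(* Let $L$ be a finite-dimensional Lie algebra over an algebraically closed field and let $M$ be a maximal subalgebra of $L$ with a maximal completion $C$ such that $C/k(C)$ is abelian. Then $M$ has an abelian ideal completion in $L$.
   Context: For a nonzero subalgebra $X$ of $L$, the strict core $k(X)$ is the sum of all ideals of $L$ that are proper subalgebras of $X$ (it is $0$ if there are none); it is an ideal of $X$. A subalgebra $C$ is a completion of $M$ if $C\not\subseteq M$ but every proper subalgebra of $C$ that is an ideal of $L$ is contained in $M$; $I(M)$ is the set of completions of $M$, partially ordered by inclusion, and a maximal completion is a maximal element of $I(M)$. An ideal completion is a completion that is an ideal of $L$; an abelian ideal completion is an ideal completion $D$ with $D/k(D)$ abelian. *)

(* Defs.v *)
From HB Require Import structures.
From mathcomp Require Import all_boot all_order all_algebra.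
From Stdlib Require Import ClassicalEpsilon.
Set Implicit Arguments. Unset Strict Implicit. Unset Printing Implicit Defensive.
Import GRing.Theory.
Local Open Scope ring_scope.

Section Lie.
Variables (F : fieldType) (L : vectType F) (br : L -> L -> L).

Definition is_lie_bracket : Prop :=
  [/\ forall (a : F) (x y z : L), br (a *: x + y) z = a *: br x z + br y z,
      forall (a : F) (x y z : L), br x (a *: y + z) = a *: br x y + br x z,
      forall x : L, br x x = 0 &
      forall x y z : L, br x (br y z) + br y (br z x) + br z (br x y) = 0].

Definition subalgebra (U : {vspace L}) : Prop :=
  forall x y, x \in U -> y \in U -> br x y \in U.

Definition lie_ideal (I : {vspace L}) : Prop :=
  forall x y, y \in I -> br x y \in I.

Definition proper_sub (U V : {vspace L}) : Prop := (U <= V)%VS /\ U <> V.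

Definition maximal_subalgebra (M : {vspace L}) : Prop :=
  [/\ subalgebra M, M <> fullv &
      forall U, subalgebra U -> (M <= U)%VS -> U = M \/ U = fullv].

(* K is the sum of all ideals of L that are proper subalgebras of X,
   i.e. the least subspace containing all of them (0 if there are none). *)
Definition is_strict_core (X K : {vspace L}) : Prop :=
  (forall I, lie_ideal I -> subalgebra I -> proper_sub I X -> (I <= K)%VS) /\
  (forall V, (forall I, lie_ideal I -> subalgebra I -> proper_sub I X ->
                (I <= V)%VS) -> (K <= V)%VS).

(* the strict core k(X) (the least upper bound above exists and is unique
   since L is finite-dimensional) *)
Definition kcore (X : {vspace L}) : {vspace L} :=
  epsilon (inhabits 0%VS) (is_strict_core X).

Definition completion (M C : {vspace L}) : Prop :=
  [/\ subalgebra C, ~ (C <= M)%VS &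
      forall I, subalgebra I -> proper_sub I C -> lie_ideal I -> (I <= M)%VS].

Definition maximal_completion (M C : {vspace L}) : Prop :=
  completion M C /\ forall C', completion M C' -> (C <= C')%VS -> C' = C.

Definition abelian_mod_kcore (X : {vspace L}) : Prop :=
  forall x y, x \in X -> y \in X -> br x y \in kcore X.

Definition ideal_completion (M D : {vspace L}) : Prop :=
  completion M D /\ lie_ideal D.

Definition abelian_ideal_completion (M D : {vspace L}) : Prop :=
  ideal_completion M D /\ abelian_mod_kcore D.

End Lie.

(* Main.v *)
Require Import Defs.
From HB Require Import structures.
From mathcomp Require Import all_boot all_order all_algebra.
From Stdlib Require Import Classical ClassicalEpsilon.
Set Implicit Arguments. Unset Strict Implicit. Unset Printing Implicit Defensive.
Import GRing.Theory VectorInternalTheory.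
Local Open Scope ring_scope.

(** Let J be the largest ideal of L inside M; then k(C) <= J, so C is abelian
    modulo J.  If J is not inside C, then C + J is not a completion, so it
    contains an ideal of L outside M, and this ideal is abelian modulo J.
    Otherwise, if C <> L, the commuting operators induced by C on L / C have a
    common eigenvector x + C.  Then C + <x> is a subalgebra that is metabelian
    modulo J; by maximality it is not a completion, so again it contains an
    ideal of L outside M.  In both cases an ideal D minimal among the ideals of
    L outside M and inside the given one is a completion, and it satisfies
    [D, D] <> D because it is solvable modulo J; hence [D, D] <= k(D). *)

(** * Extremal subspaces satisfying a predicate *)

Section Subspaces.
Variables (F : fieldType) (L : vectType F).
Implicit Types (P : {vspace L} -> Prop) (U V : {vspace L}).

Lemma ex_minimal_vspace P U : P U ->
  exists V, [/\ P V, (V <= U)%VS & forall W, P W -> (W <= V)%VS -> W = V].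
Proof.
have [n] := ubnP (\dim U); elim: n U => // n IHn U ltUn PU.
have [[V [PV sVU neVU]]|minU] :=
  classic (exists V, [/\ P V, (V <= U)%VS & V <> U]).
  have ltVU : (\dim V < \dim U)%N.
    rewrite ltnNge; apply/negP => leUV; apply: neVU; apply/eqP.
    by rewrite eqEdim sVU.
  have [W [PW sWV minW]] := IHn V (leq_trans ltVU ltUn) PV.
  by exists W; split=> //; apply: subv_trans sWV sVU.
exists U; split=> // W PW sWU; apply: NNPP => neWU.
by apply: minU; exists W.
Qed.

Lemma ex_least_vspace P : P fullv ->
    (forall U V, P U -> P V -> P (U :&: V)%VS) ->
  exists2 K, P K & forall V, P V -> (K <= V)%VS.
Proof.
move=> Pfull PI; have [K [PK _ minK]] := ex_minimal_vspace Pfull.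
exists K => // V PV.
by rewrite -(minK _ (PI _ _ PK PV) (capvSl K V)) capvSr.
Qed.

Lemma ex_greatest_vspace P : P 0%VS ->
    (forall U V, P U -> P V -> P (U + V)%VS) ->
  exists2 K, P K & forall V, P V -> (V <= K)%VS.
Proof.
move=> P0 PD.
suff [K [PK maxK]] : exists K, P K /\ forall V, P V -> (\dim V <= \dim K)%N.
  exists K => // V PV; have leKV := maxK _ (PD _ _ PK PV).
  have /eqP-> : K == (K + V)%VS by rewrite eqEdim addvSl.
  exact: addvSr.
apply: NNPP => nomax.
(* Without a member of largest dimension, the members of [P] would have unbounded dimension. *)
have big n : exists2 V, P V & (n <= \dim V)%N.
  elim: n => [|n [V PV leV]]; first by exists 0%VS.
  apply: NNPP => nobig; apply: nomax; exists V; split=> // W PW.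
  rewrite leqNgt; apply/negP => ltVW; apply: nobig; exists W => //.
  exact: leq_ltn_trans ltVW.
by have [V _] := big (\dim (fullv : {vspace L})).+1; rewrite ltnNge dimvS ?subvf.
Qed.

End Subspaces.

(** * Eigenvectors modulo a subspace *)

Section Eigenvector.
Variable F : closedFieldType.

(** Take for [s] the roots of the characteristic polynomial: the fold applies the product of the
    factors [A - a] to [v], and this product vanishes by Cayley-Hamilton. *)
Lemma ex_annihilating_seq_mx n (A : 'M[F]_n) (v : 'rV[F]_n) :
  exists s, foldr (fun a u => u *m A - a *: u) v s = 0.
Proof.
case: n A v => [|n] A v; first by exists [::]; rewrite [LHS]thinmx0.
have [s] := closed_field_poly_normal (char_poly A).
rewrite (monicP (char_poly_monic A)) scale1r => chA; exists s.
suff -> : foldr (fun a u => u *m A - a *: u) v s =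
          v *m horner_mx A (\prod_(a <- s) ('X - a%:P)).
  by rewrite -chA Cayley_Hamilton mulmx0.
elim: {chA} s => [|a s IHs]; first by rewrite big_nil rmorph1 mulmx1.
rewrite /= IHs big_cons mulrC rmorphM rmorphB /= horner_mx_X horner_mx_C.
by rewrite -mulmxE mulmxA mulmxBr mul_mx_scalar.
Qed.

Lemma ex_annihilating_seq (L : vectType F) (f : 'End(L)) (v : L) :
  exists s, foldr (fun a u => f u - a *: u) v s = 0.
Proof.
have [s s0] := ex_annihilating_seq_mx (lin1_mx (v2r \o f \o r2v)) (v2r v).
exists s; apply: v2r_inj; rewrite linear0 -{}s0.
elim: s => //= a s <-.
by rewrite mul_rV_lin1 /= v2rK linearB linearZ.
Qed.

(** The factors [f - a] carry a vector [v] of [W] outside [C] to 0, which is in [C]. The last vector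
    outside [C] along this chain is the eigenvector. *)
Lemma ex_eigenvector_mod (L : vectType F) (f : 'End(L)) (C W : {vspace L}) :
    ~~ (W <= C)%VS -> (forall w, w \in W -> f w \in W) ->
  exists a w, [/\ w \in W, w \notin C & f w - a *: w \in C].
Proof.
move=> /subvPn[v Wv C'v] fW; have [s] := ex_annihilating_seq f v.
move=> s0; have {s0} : foldr (fun a u => f u - a *: u) v s \in C.
  by rewrite s0 mem0v.
elim: s => [|a s IHs] /=; first by rewrite (negPf C'v).
set w := foldr _ _ s in IHs *.
have [/IHs //|C'w] := boolP (w \in C); exists a, w; split=> //.
rewrite /w; elim: (s) => //= b t Wt.
by rewrite rpredB ?fW ?rpredZ.
Qed.

End Eigenvector.

(** * Brackets, ideals and metabelian quotients *)

Section Lie.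
Variables (F : fieldType) (L : vectType F) (br : L -> L -> L).
Hypothesis brL : is_lie_bracket br.
Implicit Types (x y z : L) (U V I J M C D : {vspace L}).

Lemma br_linear x : linear (br x).
Proof. by case: brL => _ lin _ _ a y z; apply: lin. Qed.

Definition ad x : 'End(L) :=
  linfun (HB.pack_for {linear L -> L} (br x)
            (GRing.isLinear.Build F L L *:%R (br x) (br_linear x))).

Lemma adE x y : ad x y = br x y.
Proof. by rewrite lfunE. Qed.

Lemma brDr x y z : br x (y + z) = br x y + br x z.
Proof. by rewrite -!adE linearD. Qed.

Lemma brZr x a y : br x (a *: y) = a *: br x y.
Proof. by rewrite -!adE linearZ. Qed.

Lemma brNr x y : br x (- y) = - br x y.
Proof. by rewrite -!adE linearN. Qed.

Lemma brxx x : br x x = 0.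
Proof. by case: brL. Qed.

Lemma brDl x y z : br (x + y) z = br x z + br y z.
Proof. by case: brL => lin _ _ _; have := lin 1 x y z; rewrite !scale1r. Qed.

Lemma brC x y : br x y = - br y x.
Proof.
apply/eqP; rewrite -addr_eq0; have := brxx (x + y).
by rewrite brDl !brDr !brxx add0r addr0 => ->.
Qed.

Lemma brZl a x y : br (a *: x) y = a *: br x y.
Proof. by rewrite brC brZr -scalerN -brC. Qed.

Lemma br_jacobi x y z : br x (br y z) = br (br x y) z + br y (br x z).
Proof.
have [_ _ _ /(_ x y z)] := brL.
rewrite (brC z x) brNr (brC z (br x y)) => /eqP.
by rewrite subr_eq0 subr_eq => /eqP.
Qed.

Lemma lie_ideall I x y : lie_ideal br I -> x \in I -> br x y \in I.
Proof. by move=> idI Ix; rewrite brC rpredN idI. Qed.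

Lemma lie_ideal_subalgebra I : lie_ideal br I -> subalgebra br I.
Proof. by move=> idI x y _; apply: idI. Qed.

Lemma subalgebraD_ideal C J :
  subalgebra br C -> lie_ideal br J -> subalgebra br (C + J)%VS.
Proof.
move=> sC idJ _ _ /memv_addP[c Cc [j Jj ->]] /memv_addP[d Cd [k Jk ->]].
by rewrite brDr brDl -addrA memv_add ?sC // rpredD ?(lie_ideall _ idJ Jj) ?idJ.
Qed.

Lemma lie_idealD I J :
  lie_ideal br I -> lie_ideal br J -> lie_ideal br (I + J)%VS.
Proof.
move=> idI idJ x _ /memv_addP[i Ii [j Jj ->]].
by rewrite brDr memv_add ?idI ?idJ.
Qed.

(** Upper bounds of the ideals concerned are closed under intersection, so a least one exists for
    [epsilon] to choose. *)
Lemma kcoreP X : is_strict_core br X (kcore br X).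
Proof.
rewrite /kcore; apply: epsilon_spec.
pose P V := forall I, lie_ideal br I -> subalgebra br I -> Defs.proper_sub I X ->
                (I <= V)%VS.
have [|U V PU PV I idI sI prI|K PK leK] := @ex_least_vspace _ _ P.
- by move=> I _ _ _; apply: subvf.
- by rewrite subv_cap PU ?PV.
by exists K.
Qed.

Lemma ex_ideal_core M : exists J,
  [/\ lie_ideal br J, (J <= M)%VS &
      forall I, lie_ideal br I -> (I <= M)%VS -> (I <= J)%VS].
Proof.
have [||J [idJ sJM] maxJ] :=
    @ex_greatest_vspace _ _ (fun I => lie_ideal br I /\ (I <= M)%VS).
- split; last exact: sub0v.
  by move=> x y; rewrite memv0 => /eqP->; rewrite -adE linear0 mem0v.
- by move=> U V [idU sU] [idV sV]; rewrite subv_add sU sV; split=> //; apply: lie_idealD.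
by exists J; split=> // I idI sIM; apply: maxJ.
Qed.

Lemma ex_derived_ideal D : lie_ideal br D -> exists K,
  [/\ lie_ideal br K, (K <= D)%VS, forall y z, y \in D -> z \in D -> br y z \in K
   & forall V, (forall y z, y \in D -> z \in D -> br y z \in V) -> (K <= V)%VS].
Proof.
move=> idD.
have [||K PK leK] := @ex_least_vspace _ _
    (fun V => forall y z, y \in D -> z \in D -> br y z \in V).
- by move=> *; apply: memvf.
- by move=> U V PU PV y z Dy Dz; rewrite memv_cap PU ?PV.
exists K; split=> //; last by apply: leK => y z _ /idD.
(* By Jacobi, the preimage of [K] under [ad x] contains all brackets of elements of [D], hence
   contains [K] by leastness. *)
move=> x y Ky; rewrite -adE memv_preim.
apply: subvP Ky; apply: leK => u v Du Dv.
by rewrite -memv_preim adE br_jacobi rpredD ?PK ?idD.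
Qed.

Lemma abelian_ideal_completion_of_metabelian M J I :
    lie_ideal br J -> (J <= M)%VS -> lie_ideal br I -> ~ (I <= M)%VS ->
    (forall x y z t, x \in I -> y \in I -> z \in I -> t \in I ->
       br (br x y) (br z t) \in J) ->
  exists D, abelian_ideal_completion br M D.
Proof.
move=> idJ sJM idI nIM metaI.
have [D [[idD nDM] sDI minD]] :=
  @ex_minimal_vspace _ _ (fun V => lie_ideal br V /\ ~ (V <= M)%VS) I (conj idI nIM).
have complD E : lie_ideal br E -> Defs.proper_sub E D -> (E <= M)%VS.
  move=> idE [sED neED]; apply: NNPP => nEM; apply: neED.
  by apply: minD.
exists D; split.
  split=> //; split=> //; first exact: lie_ideal_subalgebra.
  by move=> E _ prE idE; apply: complD.
have [K [idK sKD brK leK]] := ex_derived_ideal idD.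
have [eqKD|neKD] := classic (K = D).
  (* If [D] is spanned by its brackets, then [leK], used three times, reduces [D <= J] to double
     brackets, where [metaI] applies. *)
  rewrite {}eqKD in leK; case: nDM; apply: subv_trans sJM.
  apply: (leK) => y z Dy Dz.
  rewrite -adE memv_preim; move: z Dz; apply/subvP.
  apply: (leK) => z t Dz Dt.
  rewrite -memv_preim adE brC rpredN -adE memv_preim; move: y Dy; apply/subvP.
  apply: (leK) => x y Dx Dy.
  rewrite -memv_preim adE.
  by apply: metaI; apply: (subvP sDI).
move=> x y Dx Dy; have [coreD _] := kcoreP D.
by apply: (subvP (coreD K idK (lie_ideal_subalgebra idK) (conj sKD neKD))); apply: brK.
Qed.

(* If some h in C acts on x modulo C with eigenvalue 1, say [h, x] = x + c1,
   then x' = x + c1 satisfies [h, x'] = x' modulo J; since ad h commutes with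
   ad C modulo J, [c, x'] lies in <x'> + J for every c in C. *)
Lemma metabelian_add_line J C x :
    lie_ideal br J -> subalgebra br C ->
    (forall c d, c \in C -> d \in C -> br c d \in J) ->
    (forall c, c \in C -> exists a, br c x - a *: x \in C) ->
    forall y z t u, y \in (C + <[x]>)%VS -> z \in (C + <[x]>)%VS ->
      t \in (C + <[x]>)%VS -> u \in (C + <[x]>)%VS ->
  br (br y z) (br t u) \in J.
Proof.
move=> idJ sC abC eigC.
(* Expanding a bracket of two elements of [C + <[w]>] leaves a term in [C, C], hence in [J], and
   terms in [C, w]. *)
have brB w U V : (forall c, c \in C -> br c w \in V) -> (J <= V)%VS ->
    (U <= C + <[w]>)%VS -> forall y z, y \in U -> z \in U -> br y z \in V.
  move=> CwV sJV sUB y z /(subvP sUB)/memv_addP[c Cc [_ /vlineP[a ->] ->]].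
  move=> /(subvP sUB)/memv_addP[d Cd [_ /vlineP[b ->] ->]].
  rewrite brDl !brDr !brZl !brZr brxx !scaler0 addr0.
  rewrite rpredD ?rpredD ?rpredZ ?CwV //; first exact/(subvP sJV)/abC.
  by rewrite brC rpredN CwV.
(* If all eigenvalues on [x] vanish, brackets of [C + <[x]>] fall in [C + J], which is abelian
   modulo [J]. *)
have [CxC|] := classic (forall c, c \in C -> br c x \in C).
  have brBC y z : y \in (C + <[x]>)%VS -> z \in (C + <[x]>)%VS ->
      br y z \in (C + J)%VS.
    apply: (brB x) => //; last exact: addvSr.
    by move=> c /CxC; apply/subvP; apply: addvSl.
  move=> y z t u By Bz Bt Bu.
  have /memv_addP[c Cc [j Jj ->]] := brBC _ _ By Bz.
  have /memv_addP[d Cd [k Jk ->]] := brBC _ _ Bt Bu.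
  by rewrite brDl !brDr !rpredD ?(abC c d) ?(lie_ideall _ idJ Jj) ?(idJ _ k).
move=> /not_all_ex_not[h /(imply_to_and (h \in C))[Ch nChx]].
have [a Chx] := eigC h Ch.
have a0 : a != 0 by apply/eqP => a0; apply: nChx; rewrite a0 scale0r subr0 in Chx.
(* Dividing [h] by its nonzero eigenvalue [a] gives [g], with eigenvalue 1. *)
pose x' := a^-1 *: br h x; pose g := a^-1 *: h.
have Cg : g \in C by rewrite rpredZ.
have Cx' : x' - x \in C.
  have -> : x' - x = a^-1 *: (br h x - a *: x).
    by rewrite scalerBr scalerA mulVf // scale1r.
  by rewrite rpredZ.
have gx' : br g x' - x' \in J.
  have -> : br g x' - x' = br g (x' - x).
    by rewrite (brDr g x') brNr [br g x]brZl.
  exact: abC.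
clearbody x' g.
have Cx'V c : c \in C -> br c x' \in (<[x']> + J)%VS.
  move=> Cc; have [b Cb] := eigC c Cc.
  pose d := br c x' - b *: x'.
  have Cd : d \in C.
    have -> : d = (br c x - b *: x) + (br c (x' - x) - b *: (x' - x)).
      by rewrite addrACA -brDr -opprD -scalerDr [x + _]addrC subrK.
    by rewrite rpredD // rpredB ?rpredZ ?sC.
  have Jd : d \in J.
    (* By Jacobi, [g, d] is [d] up to the error [r] in [J]; but [g] and [d] are both in [C], so
       [g, d] is in [J]. *)
    pose e := br g x' - x'.
    pose r := br (br g c) x' + br c e - b *: e.
    have Jr : r \in J.
      by rewrite rpredB ?rpredD ?rpredZ ?(idJ _ e) // lie_ideall ?abC.
    rewrite -(rpredDr _ Jr).
    have -> : d + r = br g d; last exact: abC.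
    have gx'E : br g x' = x' + e by rewrite addrC subrK.
    rewrite [br g d]brDr brNr brZr [br g (br c x')]br_jacobi gx'E.
    rewrite [br c (x' + e)]brDr scalerDr opprD.
    by rewrite [br _ x' + (_ + _)]addrCA addrACA.
  have -> : br c x' = b *: x' + d by rewrite addrC subrK.
  by rewrite memv_add // rpredZ ?memv_line.
have sB : (C + <[x]> <= C + <[x']>)%VS.
  rewrite subv_add addvSl /= -memvE.
  have -> : x = - (x' - x) + x' by rewrite opprB subrK.
  by rewrite memv_add ?rpredN ?memv_line.
move=> y z t u By Bz Bt Bu.
have brBV := brB x' _ _ Cx'V (addvSr _ _) sB.
have /memv_addP[_ /vlineP[b ->] [j Jj ->]] := brBV _ _ By Bz.
have /memv_addP[_ /vlineP[c ->] [k Jk ->]] := brBV _ _ Bt Bu.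
rewrite brDl !brDr !brZl !brZr brxx !scaler0 add0r.
by rewrite !rpredD ?rpredZ ?(lie_ideall _ idJ Jj) ?(idJ _ k).
Qed.

End Lie.

Lemma ex_common_eigenvector_mod (F : closedFieldType) (L : vectType F)
    (br : L -> L -> L) (J C : {vspace L}) :
    is_lie_bracket br -> lie_ideal br J -> (J <= C)%VS -> C <> fullv ->
    (forall c d, c \in C -> d \in C -> br c d \in J) ->
  exists2 x, x \notin C & forall c, c \in C -> exists a, br c x - a *: x \in C.
Proof.
move=> brL idJ sJC neC abC.
(* A minimal [C]-stable [W] strictly above [C] consists of common eigenvectors modulo [C]. *)
pose P W := [/\ (C <= W)%VS, ~~ (W <= C)%VS &
               forall c w, c \in C -> w \in W -> br c w \in W].
have Pfull : P fullv.
  split=> [||*]; rewrite ?subvf ?memvf //.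
  by apply/negP => sC; apply: neC; apply/eqP; rewrite eqEsubv subvf.
have [W [[sCW nWC CW] _ minW]] := ex_minimal_vspace Pfull.
have /subvPn[x Wx C'x] := nWC; exists x => // c Cc.
have [w Ww|a [w [Ww C'w Cfw]]] := ex_eigenvector_mod (f := ad brL c) nWC.
  by rewrite adE CW.
(* The eigenspace [E] of [c] in [W] is again stable, since [C] is abelian modulo [J]; minimality
   forces [E = W], so [x], chosen before [c], lies in it. *)
exists a; pose E := (W :&: (ad brL c - a *: \1)%VF @^-1: C)%VS.
have memE u : (u \in E) = (u \in W) && (br c u - a *: u \in C).
  by rewrite memv_cap -memv_preim add_lfunE opp_lfunE scale_lfunE id_lfunE adE.
suff EW : E = W by move: Wx; rewrite -EW memE => /andP[].
apply: minW; last exact: capvSl.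
split.
- apply/subvP => d Cd; rewrite memE (subvP sCW) //=.
  by rewrite rpredB ?rpredZ // (subvP sJC) ?abC.
- by apply/subvPn; exists w; rewrite // memE Ww -(adE brL).
move=> d u Cd; rewrite !memE => /andP[Wu Cu]; rewrite CW //=.
rewrite (br_jacobi brL) -(brZr brL) -addrA -(brNr brL) -(brDr brL).
rewrite rpredD // (subvP sJC) //; last exact: abC.
by rewrite (lie_ideall brL) ?abC.
Qed.

Theorem theorem3p3 (F : closedFieldType) (L : vectType F) (br : L -> L -> L)
    (M C : {vspace L}) :
  is_lie_bracket br ->
  maximal_subalgebra br M ->
  maximal_completion br M C ->
  abelian_mod_kcore br C ->
  exists D : {vspace L}, abelian_ideal_completion br M D.
Proof.
move=> brL _ [[sC nCM complC] maxC] abkC.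
have [Cfull|neC] := classic (C = fullv).
  by exists C; split=> //; split=> // x y _; rewrite Cfull memvf.
have [J [idJ sJM maxJ]] := ex_ideal_core brL M.
have abC c d : c \in C -> d \in C -> br c d \in J.
  move=> Cc Cd; have [_ leK] := kcoreP br C.
  apply: subvP (abkC c d Cc Cd); apply: leK => I idI sI prI.
  by apply: maxJ => //; apply: complC.
(* A subalgebra strictly above [C] is not a completion and is not inside [M], so only the condition
   on ideals can fail. *)
have ex_ideal B : subalgebra br B -> (C <= B)%VS -> B <> C ->
    exists I, [/\ lie_ideal br I, (I <= B)%VS & ~ (I <= M)%VS].
  move=> sB sCB neBC; apply: NNPP => noI; apply/neBC/maxC => //.
  split=> // [sBM|I sI [sIB _] idI]; first by apply/nCM/(subv_trans sCB).
  by apply: NNPP => nIM; apply: noI; exists I.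
(* The inclusion of [J] in [C] is what makes the operators induced on L / C commute. *)
have [sJC|nJC] := boolP (J <= C)%VS.
  have [x C'x eigC] := ex_common_eigenvector_mod brL idJ sJC neC abC.
  have metaB := metabelian_add_line brL idJ sC abC eigC.
  have [||I [idI sIB nIM]] := ex_ideal (C + <[x]>)%VS _ (addvSl _ _).
  - move=> _ _ /memv_addP[c Cc [_ /vlineP[a ->] ->]]
            /memv_addP[d Cd [_ /vlineP[b ->] ->]].
    have Bx e : e \in C -> br e x \in (C + <[x]>)%VS.
      move=> Ce; have [k Ck] := eigC e Ce.
      by rewrite -(subrK (k *: x) (br e x)) memv_add ?rpredZ ?memv_line.
    rewrite (brDl brL) !(brDr brL) !(brZl brL) !(brZr brL) (brxx brL) !scaler0 addr0.
    rewrite rpredD ?rpredD ?rpredZ ?Bx //.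
      by apply: (subvP (addvSl C _)); apply: sC.
    by rewrite (brC brL) rpredN Bx.
  - move=> eqBC; move/negP: C'x; apply; rewrite -eqBC.
    exact: (subvP (addvSr _ _) _ (memv_line x)).
  apply: (abelian_ideal_completion_of_metabelian brL idJ sJM idI nIM).
  by move=> y z t u Iy Iz It Iu; apply: metaB; apply: (subvP sIB).
have [||I [idI sIB nIM]] := ex_ideal (C + J)%VS _ (addvSl _ _).
- exact: subalgebraD_ideal.
- by move=> eqBC; move/negP: nJC; apply; rewrite -eqBC addvSr.
apply: (abelian_ideal_completion_of_metabelian brL idJ sJM idI nIM).
move=> y z t u Iy Iz _ _; apply: lie_ideall => //.
move/(subvP sIB)/memv_addP: Iy => [c Cc [j Jj ->]].
move/(subvP sIB)/memv_addP: Iz => [d Cd [k Jk ->]].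
by rewrite (brDl brL) (brDr brL) !rpredD ?(abC c d) ?(lie_ideall brL _ idJ Jj) ?(idJ _ k).
Qed.
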